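(* Let $\mu=\mu(T,a,p)$ be a homogeneous self-similar measure on $\mathbb{R}^d$, where $T$ is an invertible contractive linear similarity of $\mathbb{R}^d$, $a=(a_1,\ldots,a_m)\in(\mathbb{R}^d)^m$ and $p\in\mathbb{P}_m$. Then $$D_1\mu=\lim_{q\to1^+}D_q\mu.$$
   Context: $\mathbb{P}_m=\{(p_1,\ldots,p_m):p_i>0,\ \sum_i p_i=1\}$. With $f_i(x)=Tx+a_i$, $\mu(T,a,p)$ is the unique Borel probability measure $\mu$ on $\mathbb{R}^d$ with $\mu=\sum_{i=1}^m p_i f_i\mu$, where $f\mu(B)=\mu(f^{-1}B)$. Let $\mathcal{D}_n$ be the partition of $\mathbb{R}^d$ into dyadic cubes of side length $2^{-n}$; logarithms are to base 2. For $q>0$, $q\ne1$, $D_q\mu=\liminf_{n\to\infty}\frac{\log S_{n,q}\mu}{(1-q)n}$ with $S_{n,q}\mu=\sum_{I\in\mathcal{D}_n}\mu(I)^q$. The entropy (information) dimension is $D_1\mu=\liminf_{n\to\infty}\frac{H_n\mu}{n}$ with $H_n\mu=\sum_{I\in\mathcal{D}_n}\mu(I)\log(1/\mu(I))$ (with the convention $0\log(1/0)=0$). *)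

(* Defs.v *)
From HB Require Import structures.
From mathcomp Require Import all_boot all_order all_algebra.
From mathcomp Require Import all_classical all_reals all_analysis.

Set Implicit Arguments.
Unset Strict Implicit.
Unset Printing Implicit Defensive.

Import Order.TTheory GRing.Theory Num.Theory.
Import numFieldNormedType.Exports.

Local Open Scope classical_set_scope.
Local Open Scope ring_scope.

Notation borelRd R d := (g_sigma_algebraType (@open 'rV[R]_d)).

(* The library's norm on matrices is the sup norm, for which the isometries
   are not the orthogonal maps; similarities need the Euclidean one. *)
Definition enorm (R : realType) (d : nat) (x : 'rV[R]_d) : R :=
  Num.sqrt (\sum_(i < d) x ord0 i ^+ 2).

Definition invertible_contractive_similarity (R : realType) (d : nat)
    (T : 'rV[R]_d -> 'rV[R]_d) : Prop :=
  bijective T /\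
  exists2 r : R, 0 < r < 1 & forall x, enorm (T x) = r * enorm x.

Definition prob_vectors (R : realType) (m : nat) : set ('I_m -> R) :=
  [set p | (forall i, 0 < p i) /\ \sum_(i < m) p i = 1].

Definition affine_map (R : realType) (d : nat) (T : 'rV[R]_d -> 'rV[R]_d)
    (b : 'rV[R]_d) (x : borelRd R d) : borelRd R d := T x + b.

(* By Hutchinson's theorem exactly one Borel probability measure has this
   property when T is a linear contraction and p is in prob_vectors. *)
Definition is_self_similar_measure (R : realType) (d m : nat)
    (T : 'rV[R]_d -> 'rV[R]_d) (a : 'I_m -> 'rV[R]_d) (p : 'I_m -> R)
    (mu : probability (borelRd R d) R) : Prop :=
  forall B : set (borelRd R d), measurable B ->
    mu B = (\sum_(i < m)
              (p i)%:E * pushforward mu (affine_map T (a i)) B)%E.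

Definition dyadic_cube (R : realType) (d n : nat) (k : 'rV[int]_d) :
    set 'rV[R]_d :=
  [set x : 'rV[R]_d | forall i : 'I_d,
    (k ord0 i)%:~R / 2 ^+ n <= x ord0 i < (k ord0 i + 1)%:~R / 2 ^+ n].

Definition dyadic_cubes (R : realType) (d n : nat) : set (set 'rV[R]_d) :=
  range (@dyadic_cube R d n).

Definition log2e (R : realType) (x : \bar R) : \bar R :=
  (lne x * ((ln 2)^-1)%:E)%E.

Section Dimensions.
Context (R : realType) (d : nat).
Implicit Types (mu : probability (borelRd R d) R) (q : R) (n : nat).

Definition moment_sum mu n q : \bar R :=
  (\esum_(I in @dyadic_cubes R d n) mu I `^ q)%E.

Definition entropy mu n : \bar R :=
  (* a null cube contributes 0 * log2e +oo = 0 *)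
  (\esum_(I in @dyadic_cubes R d n) (mu I * log2e (mu I)^-1))%E.

(* Meant for q > 0, q != 1. The term n = 0 divides by 0 (with value 0), which
   the lower limit ignores; likewise in D1. *)
Definition Dq mu q : \bar R :=
  limn_einf (fun n => log2e (moment_sum mu n q)
                      * (((1 - q) * n%:R)^-1)%:E)%E.

Definition D1 mu : \bar R :=
  limn_einf (fun n => entropy mu n * (n%:R^-1)%:E)%E.

End Dimensions.

(* Main.v *)
(* For [q > 1] put R_n(q) = - log S_{n,q} / (q - 1). Jensen's inequality gives
   R_n(q) <= H_n, hence D_q <= D_1. Conversely, writing mu as the convolution of
   a discrete measure with a copy of mu under T^j of ratio about 2^-k, and using convexity
   of x^q, one finds a constant C, independent of n, k and of q in (1, 2], with
   S_{n+k,q} <= exp ((q - 1) C) S_{n,q} S_{k,q}. So R_n(q) is superadditive in n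
   up to the additive constant C, and D_q >= (R_k(q) - C) / k for every k. For
   fixed k, R_k(q) tends to H_k as q -> 1+, so that
   liminf_{q -> 1+} D_q >= (H_k - C) / k, and it remains to let k go to infinity. *)
Require Import Defs.
From HB Require Import structures.
From mathcomp Require Import all_boot all_order all_algebra.
From mathcomp Require Import all_classical all_reals all_analysis.
From mathcomp Require Import ring lra zify.

Set Implicit Arguments.
Unset Strict Implicit.
Unset Printing Implicit Defensive.

Import Order.TTheory GRing.Theory Num.Theory.
Import numFieldNormedType.Exports.

Local Open Scope classical_set_scope.
Local Open Scope ring_scope.

(** Dividing logarithms by [q - 1] turns any fixed factor other than 1 into an error that blows up
    as q -> 1+. Every loss must therefore carry [q - 1] in its exponent: a number M of neighbouring
    cubes may enter only as M^(q - 1), or through a sum that Young's inequality has multiplied by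
    [q - 1]. The copies of mu may overlap arbitrarily, so the number of words meeting a cube is
    uncontrolled; Jensen is applied with the weights of these words instead of their number, and the
    weights are compared with masses of large cubes. Homogeneity enters because all words of one
    length share the linear part T^j, so that a single length fits the scale 2^-k. Boundedness of
    the support turns all sums into finite ones. *)

(** * Power sums *)

Section PowerSums.
Context {R : realType}.
Implicit Types (q : R) (I J K W : finType).

Lemma powR_young (x y q : R) : 0 <= x -> 0 <= y -> 1 < q ->
  q * (x * y `^ (q - 1)) <= x `^ q + (q - 1) * y `^ q.
Proof.
move=> x0 y0 q1; have q0 : 0 < q by lra.
have q10 : 0 < q - 1 by lra.
have := @conjugate_powR R x (y `^ (q - 1)) q (q / (q - 1)) x0 (powR_ge0 _ _) q0.
rewrite divr_gt0// => /(_ isT).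
have -> : q^-1 + (q / (q - 1))^-1 = 1.
  by rewrite invf_div -{1}[q^-1]mul1r -mulrDl addrC subrK divff// gt_eqF.
move=> /(_ erefl); rewrite -powRrM.
have -> : (q - 1) * (q / (q - 1)) = q by rewrite mulrC divfK// gt_eqF.
rewrite -(ler_pM2l q0) => /le_trans; apply; rewrite mulrDr.
by rewrite mulrCA divff ?gt_eqF// mulr1 lerD2l invf_div mulrCA [_ * (_ / q)]mulrC
  divfK ?gt_eqF// mulrC.
Qed.

Lemma powR_superadditive I (x : I -> R) q : 1 < q -> (forall i, 0 <= x i) ->
  \sum_i x i `^ q <= (\sum_i x i) `^ q.
Proof.
move=> q1 x0; have q0 : 0 < q by lra.
rewrite -(@mulr_powRB1 R (\sum_i x i)) ?sumr_ge0// mulr_suml.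
apply: ler_sum => i _; rewrite -(@mulr_powRB1 R (x i))//.
rewrite ler_wpM2l// ge0_ler_powR ?nnegrE ?sumr_ge0//; first lra.
by rewrite (bigD1 i)//= lerDl sumr_ge0.
Qed.

(** The weights are not normalised, and only those of indices with [x i != 0] are charged to [C]:
    with words as indices, this confines the factor to the words reaching a given cube. *)
Lemma powR_jensen I (c x : I -> R) (C q : R) : 1 < q -> 0 <= C ->
  (forall i, 0 <= c i) -> (forall i, 0 <= x i) ->
  \sum_(i | x i != 0) c i <= C ->
  (\sum_i c i * x i) `^ q <= C `^ (q - 1) * \sum_i c i * x i `^ q.
Proof.
move=> q1 C0 c0 x0 hC; have q0 : 0 < q by lra.
have q10 : 0 < q - 1 by lra.
set X := \sum_i c i * x i.
have X0 : 0 <= X by apply: sumr_ge0 => i _; rewrite mulr_ge0.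
have S0 : 0 <= \sum_i c i * x i `^ q.
  by apply: sumr_ge0 => i _; rewrite mulr_ge0 ?powR_ge0.
have [C00|Cn0] := eqVneq C 0.
  suff -> : X = 0 by rewrite powR0 ?gt_eqF// mulr_ge0 ?powR_ge0.
  apply: big1 => i _; have [->|xi] := eqVneq (x i) 0; first by rewrite mulr0.
  suff -> : c i = 0 by rewrite mul0r.
  apply/eqP; rewrite eq_le c0 andbT; apply: le_trans (_ : 0 <= 0 :> R) => //.
  rewrite -{1}C00; apply: le_trans hC; rewrite (bigD1 i)//= lerDl.
  by apply: sumr_ge0.
have Cgt0 : 0 < C by rewrite lt_neqAle eq_sym Cn0.
(* [t] plays the role of the mean. Young's inequality at [t] is the tangent line to x^q there, and
   the two terms in [t] become q and q - 1 copies of X^q / C^(q - 1). *)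
set t := X / C.
have t0 : 0 <= t by rewrite divr_ge0.
have : q * (X * t `^ (q - 1)) <=
    \sum_i c i * x i `^ q + (q - 1) * (C * t `^ q).
  have -> : q * (X * t `^ (q - 1)) =
      \sum_(i | x i != 0) c i * (q * (x i * t `^ (q - 1))).
    rewrite /X mulrC -mulrA mulr_suml [LHS](bigID (fun i => x i != 0))/=.
    rewrite [X in _ + X]big1 ?addr0; last first.
      by move=> i /negPn/eqP ->; rewrite mulr0 mul0r.
    by apply: eq_bigr => i _; ring.
  apply: (@le_trans _ _ (\sum_(i | x i != 0)
      c i * (x i `^ q + (q - 1) * t `^ q))).
    by apply: ler_sum => i _; rewrite ler_wpM2l// powR_young.
  under eq_bigr do rewrite mulrDr.
  rewrite big_split/= lerD//.
    rewrite [leRHS](bigID (fun i => x i != 0))/= lerDl.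
    by apply: sumr_ge0 => i _; rewrite mulr_ge0 ?powR_ge0.
  by rewrite -mulr_suml mulrCA ler_wpM2l ?(ltW q10)// ler_wpM2r ?powR_ge0.
have -> : X * t `^ (q - 1) = X `^ q / C `^ (q - 1).
  by rewrite powRM ?invr_ge0// mulrA mulr_powRB1// -powR_inv1// -powRrM mulN1r powRN.
have -> : C * t `^ q = X `^ q / C `^ (q - 1).
  rewrite powRM ?invr_ge0// -powR_inv1// -powRrM mulN1r powRN mulrCA.
  congr (_ * _); rewrite -[in X in _ / X](@mulr_powRB1 R C)// invfM mulrA divff//.
  by rewrite mul1r.
move=> h; have {}h : X `^ q / C `^ (q - 1) <= \sum_i c i * x i `^ q.
  move: h; set a := X `^ q / _; set b := \sum_i _; lra.
by rewrite mulrC -ler_pdivrMr// powR_gt0.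
Qed.

Lemma powR_sum_card I (x : I -> R) (M : nat) q : 1 < q ->
  (forall i, 0 <= x i) -> (#|[pred i | x i != 0%R]| <= M)%N ->
  (\sum_i x i) `^ q <= M%:R `^ (q - 1) * \sum_i x i `^ q.
Proof.
move=> q1 x0 hM.
have e (y : I -> R) : \sum_i y i = \sum_i 1 * y i.
  by apply: eq_bigr => i _; rewrite mul1r.
rewrite (e x) (e (fun i => x i `^ q)); apply: powR_jensen => //.
by rewrite sumr_const ler_nat.
Qed.

(** Cutting each row into at most [M] nonzero pieces costs M^(q - 1) by Jensen; regrouping the
    pieces by column is free, by superadditivity. *)
Lemma power_sum_partition I K (g : I -> K -> R) (M : nat) q : 1 < q ->
  (forall i k, 0 <= g i k) ->
  (forall i, (#|[pred k | g i k != 0%R]| <= M)%N) ->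
  \sum_i (\sum_k g i k) `^ q <=
    M%:R `^ (q - 1) * \sum_k (\sum_i g i k) `^ q.
Proof.
move=> q1 g0 hM.
apply: (@le_trans _ _ (\sum_i M%:R `^ (q - 1) * \sum_k g i k `^ q)).
  by apply: ler_sum => i _; exact: powR_sum_card.
rewrite -mulr_sumr ler_wpM2l ?powR_ge0// exchange_big/=.
by apply: ler_sum => k _; exact: powR_superadditive.
Qed.

(** Young's inequality separates [u j] from its neighbourhood sum and puts [q - 1] before the power
    sum of the latter. That power sum may then be bounded crudely, with constant M^2, and 1 + t <=
    e^t produces the exponential. *)
Lemma power_sum_near J (near : rel J) (u : J -> R) (M : nat) q : 1 < q ->
  q <= 2 -> (forall j, 0 <= u j) ->
  (forall j, (#|[pred j' | near j j']| <= M)%N) ->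
  (forall j, (#|[pred j' | near j' j]| <= M)%N) ->
  \sum_j u j * (\sum_(j' | near j j') u j') `^ (q - 1) <=
    expR ((q - 1) * (M%:R ^+ 2)) * \sum_j u j `^ q.
Proof.
move=> q1 q2 u0 hM hM'; have q0 : 0 < q by lra.
set S := \sum_j u j `^ q.
have S0 : 0 <= S by apply: sumr_ge0 => j _; rewrite powR_ge0.
pose y j := \sum_(j' | near j j') u j'.
have y0 j : 0 <= y j by apply: sumr_ge0.
have hy : \sum_j y j `^ q <= M%:R ^+ 2 * S.
  apply: (@le_trans _ _ (\sum_j M%:R `^ (q - 1) *
      \sum_j' (if near j j' then u j' else 0) `^ q)).
    apply: ler_sum => j _; rewrite /y big_mkcond/=; apply: powR_sum_card => //.
      by move=> j'; case: ifP.
    apply: leq_trans (hM j); apply: subset_leq_card; apply/fintype.subsetP => j'.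
    by rewrite !inE; case: ifP => //; rewrite eqxx.
  rewrite -mulr_sumr exchange_big/=.
  apply: (@le_trans _ _ (M%:R `^ (q - 1) * \sum_j M%:R * u j `^ q)).
    rewrite ler_wpM2l ?powR_ge0//; apply: ler_sum => j _.
    rewrite (eq_bigr (fun i => if near i j then u j `^ q else 0)); last first.
      by move=> i _; case: ifP => // _; rewrite powR0// gt_eqF.
    rewrite -big_mkcond/= sumr_const -[leLHS]mulr_natl.
    by rewrite ler_wpM2r ?powR_ge0// ler_nat hM'.
  (* The two factors combine to M^q, which is at most M^2 since [q <= 2]. *)
  rewrite -mulr_sumr mulrA ler_wpM2r// mulrC mulr_powRB1//.
  have [->|Mgt0] := posnP M; first by rewrite powR0 ?gt_eqF// expr0n.
  by rewrite -powR_mulrn// ler_powR// ler1n.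
have h : q * \sum_j u j * y j `^ (q - 1) <= S + (q - 1) * (M%:R ^+ 2 * S).
  rewrite mulr_sumr; apply: (@le_trans _ _
      (\sum_j (u j `^ q + (q - 1) * y j `^ q))).
    by apply: ler_sum => j _; exact: powR_young.
  by rewrite big_split/= -mulr_sumr lerD2l ler_wpM2l//; lra.
have {}h : \sum_j u j * y j `^ (q - 1) <= S + (q - 1) * (M%:R ^+ 2 * S).
  apply: le_trans h; apply: ler_peMl; last exact: ltW.
  by apply: sumr_ge0 => j _; rewrite mulr_ge0 ?powR_ge0.
apply: (le_trans h).
rewrite mulrA -{1}[S]mul1r -mulrDl ler_wpM2r//.
exact: expR_ge1Dx.
Qed.

(* [w] ranges over the words with weights [P w], and [alpha w i], [beta w j] are
   the masses of the preimages of a small cube [i] and of a large cube [j] under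
   the map of [w]. Jensen bounds the term of [i] with the factor
   [(N i) ^ (q - 1)], where [N i] is the weight of the words reaching [i].
   Since these words land near every large cube [j] reached by one of them, [w],
   the factor is at most the average [Phi w] over [j], which depends on [w] only. *)
Lemma power_sum_submul W I J (near : rel J) (P : W -> R)
    (alpha : W -> I -> R) (beta : W -> J -> R) (A q : R) : 1 < q ->
  (forall w, 0 <= P w) -> \sum_w P w = 1 ->
  (forall w i, 0 <= alpha w i) -> (forall w j, 0 <= beta w j) ->
  (forall w, P w != 0 -> \sum_j beta w j = 1) ->
  (forall i w w' j j', alpha w i != 0 -> alpha w' i != 0 ->
    beta w j != 0 -> beta w' j' != 0 -> near j j') ->
  (forall w, \sum_i alpha w i `^ q <= A) ->
  \sum_i (\sum_w P w * alpha w i) `^ q <=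
    A * \sum_j (\sum_w P w * beta w j) *
        (\sum_(j' | near j j') \sum_w P w * beta w j') `^ (q - 1).
Proof.
move=> q1 P0 P1 a0 b0 b1 hnear hA.
pose u j := \sum_w P w * beta w j.
pose y j := \sum_(j' | near j j') u j'.
have u0 j : 0 <= u j by apply: sumr_ge0 => w _; rewrite mulr_ge0.
have y0 j : 0 <= y j by apply: sumr_ge0.
pose Phi w := \sum_j beta w j * y j `^ (q - 1).
have Phi0 w : 0 <= Phi w by apply: sumr_ge0 => j _; rewrite mulr_ge0 ?powR_ge0.
pose N i := \sum_(w | alpha w i != 0) P w.
have N0 i : 0 <= N i by apply: sumr_ge0.
have Ny i w j : alpha w i != 0 -> beta w j != 0 -> N i <= y j.
  move=> awi bwj; rewrite /y /u exchange_big/= /N.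
  rewrite [leRHS](bigID (fun w' => alpha w' i != 0))/= ler_wpDr//.
    by apply: sumr_ge0 => w' _; apply: sumr_ge0 => j' _; rewrite mulr_ge0.
  apply: ler_sum => w' aw'i; rewrite -mulr_sumr.
  have [->|Pw'] := eqVneq (P w') 0; first by rewrite mul0r.
  suff -> : \sum_(j' | near j j') beta w' j' = 1 by rewrite mulr1.
  rewrite -(b1 w')// [RHS](bigID (near j))/= [X in _ + X]big1 ?addr0//.
  move=> j' njj'; apply/eqP/negPn/negP => bw'j'.
  by move/negP: njj'; apply; exact: (hnear i w w').
have NPhi i w : P w != 0 -> alpha w i != 0 -> N i `^ (q - 1) <= Phi w.
  move=> Pw awi; rewrite -[leLHS]mul1r -[X in X * _ <= _](b1 w Pw) mulr_suml.
  apply: ler_sum => j _; have [->|bwj] := eqVneq (beta w j) 0.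
    by rewrite !mul0r.
  rewrite ler_wpM2l// ge0_ler_powR ?nnegrE//; first lra.
  exact: (Ny i w).
apply: (@le_trans _ _ (\sum_i \sum_w Phi w * (P w * alpha w i `^ q))).
  apply: ler_sum => i _.
  apply: (@le_trans _ _ (N i `^ (q - 1) * \sum_w P w * alpha w i `^ q)).
    exact: powR_jensen.
  rewrite mulr_sumr; apply: ler_sum => w _.
  have [->|Pw] := eqVneq (P w) 0; first by rewrite !(mul0r, mulr0).
  have [->|awi] := eqVneq (alpha w i) 0.
    by rewrite powR0 ?gt_eqF ?(mul0r, mulr0)//; lra.
  by rewrite ler_wpM2r ?NPhi// mulr_ge0 ?powR_ge0.
rewrite exchange_big/=.
apply: (@le_trans _ _ (\sum_w Phi w * (P w * A))).
  by apply: ler_sum => w _; rewrite -!mulr_sumr !ler_wpM2l.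
rewrite le_eqVlt; apply/orP; left; apply/eqP.
have -> : \sum_w Phi w * (P w * A) = A * \sum_w P w * Phi w.
  by rewrite mulr_sumr; apply: eq_bigr => w _; ring.
congr (_ * _).
have -> : \sum_w P w * Phi w = \sum_w \sum_j P w * (beta w j * y j `^ (q - 1)).
  by apply: eq_bigr => w _; rewrite mulr_sumr.
rewrite exchange_big/=; apply: eq_bigr => j _.
by rewrite mulr_suml; apply: eq_bigr => w _; rewrite -/(y j); ring.
Qed.

End PowerSums.

(** * Power sums and entropy for exponents close to 1 *)

Section Entropy.
Context {R : realType} {J : finType}.
Variables (u : J -> R).
Hypotheses (u0 : forall j, 0 <= u j) (u1 : \sum_j u j = 1).

Definition nat_entropy : R := \sum_j u j * - ln (u j).

(** Jensen for exp under the weights [u], since u^q = u e^((q - 1) ln u). The tangent of exp at the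
    mean [- h] is used; its linear part averages to zero. *)
Lemma power_sum_ge_entropy (q : R) : 1 < q ->
  expR (- ((q - 1) * nat_entropy)) <= \sum_j u j `^ q.
Proof.
move=> q1; set h := (q - 1) * nat_entropy.
have -> : expR (- h) = \sum_j expR (- h) * (u j * (1 + ((q - 1) * ln (u j) + h))).
  rewrite -mulr_sumr; under eq_bigr do rewrite !mulrDr mulr1.
  rewrite !big_split/= u1 -mulr_suml u1 mul1r.
  rewrite (_ : \sum_j _ = - h); first by rewrite addNr addr0 mulr1.
  rewrite /h /nat_entropy mulr_sumr -sumrN; apply: eq_bigr => j _; ring.
apply: ler_sum => j _; have [->|uj] := eqVneq (u j) 0.
  by rewrite mul0r mulr0 powR_ge0.
rewrite -(@mulr_powRB1 R (u j))//; last lra.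
rewrite mulrCA ler_wpM2l// /powR (negPf uj).
rewrite -[X in X <= _]mulr1 -[in leRHS](addKr h (_ * _)) expRD.
rewrite mulr1 ler_pM2l ?expR_gt0//.
by rewrite [h + _]addrC; exact: expR_ge1Dx.
Qed.

(** The matching upper bound, with an error of second order in [q - 1]. The error depends on [u], so
    it serves at a fixed scale as q -> 1. *)
Lemma power_sum_le_entropy (q : R) : 1 < q ->
  (forall j, u j <= 1) ->
  \sum_j u j `^ q <=
    1 - (q - 1) * (nat_entropy - (q - 1) * \sum_j u j * ln (u j) ^+ 2).
Proof.
move=> q1 ule1.
have -> : 1 - (q - 1) * (nat_entropy - (q - 1) * \sum_j u j * ln (u j) ^+ 2) =
    \sum_j u j * (1 + (q - 1) * ln (u j) + ((q - 1) * ln (u j)) ^+ 2).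
  rewrite /nat_entropy -{1}u1 mulr_sumr -sumrB mulr_sumr -sumrB.
  by apply: eq_bigr => j _; ring.
apply: ler_sum => j _; have [->|uj] := eqVneq (u j) 0.
  by rewrite powR0 ?mul0r// gt_eqF//; lra.
rewrite -(@mulr_powRB1 R (u j))//; last lra.
rewrite ler_wpM2l// /powR (negPf uj).
(* For t <= 0: e^t = 1 / e^(-t) <= 1 / (1 - t) <= 1 + t + t^2. *)
have : 0 <= - ((q - 1) * ln (u j)).
  by rewrite -mulrN mulr_ge0 ?oppr_ge0 ?ln_le0//; lra.
set t := _ * ln _ => t0.
rewrite -[t in expR t]opprK expRN.
have e0 : 0 < 1 - t by lra.
apply: (@le_trans _ _ (1 - t)^-1).
  by rewrite lef_pV2 ?posrE ?expR_gt0//; exact: expR_ge1Dx.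
rewrite -div1r ler_pdivrMr//.
have -> : (1 + t + t ^+ 2) * (1 - t) = 1 - t ^+ 3 by ring.
have : 0 <= (- t) ^+ 3 by rewrite exprn_ge0.
by rewrite (_ : (- t) ^+ 3 = - t ^+ 3); [lra|ring].
Qed.

End Entropy.

(** * Finite partitions and dyadic cubes *)

Section Partition.
Context {disp : measure_display} {T : measurableType disp} {R : realType}.
Variable (mu : probability T R).

Lemma fine_measure_le (A B : set T) : measurable A -> measurable B ->
  A `<=` B -> fine (mu A) <= fine (mu B).
Proof.
by move=> mA mB AB; rewrite fine_le ?fin_num_measure// le_measure ?inE.
Qed.

Lemma fine_measure_ge0 (A : set T) : 0 <= fine (mu A).
Proof. exact: fine_ge0. Qed.

Lemma fine_measure_null (A B : set T) : measurable A -> measurable B ->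
  mu B = 0%E -> A `<=` B -> fine (mu A) = 0.
Proof.
move=> mA mB B0 AB; apply/eqP; rewrite eq_le fine_measure_ge0 andbT.
by rewrite (le_trans (fine_measure_le mA mB AB))// B0.
Qed.

Context {I : finType} (C : I -> set T).
Hypotheses (mC : forall i, measurable (C i)) (tC : trivIset setT C).

Lemma measurable_finite_cover : measurable (\bigcup_i C i).
Proof. by apply: fin_bigcup_measurable. Qed.

Lemma fine_measure_partition_cover (A : set T) : measurable A ->
  \sum_i fine (mu (A `&` C i)) = fine (mu (A `&` \bigcup_i C i)).
Proof.
move=> mA; rewrite setI_bigcupr.
have -> : [set: I] = [set` index_enum I].
  by apply/seteqP; split => i //= _; rewrite mem_index_enum.
rewrite measure_fin_bigcup//; last 2 first.
- by apply: trivIset_setIl; apply: sub_trivIset tC.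
- by move=> i _; exact: measurableI.
rewrite -fsbig_seq ?index_enum_uniq// sum_fine// => i _.
by apply: fin_num_measure; exact: measurableI.
Qed.

Lemma fine_measure_partition_le (A : set T) : measurable A ->
  \sum_i fine (mu (A `&` C i)) <= fine (mu A).
Proof.
move=> mA; rewrite fine_measure_partition_cover//; apply: fine_measure_le => //.
by apply: measurableI => //; exact: measurable_finite_cover.
Qed.

Lemma fine_measure_partition (A : set T) : measurable A ->
  mu (~` \bigcup_i C i) = 0%E ->
  fine (mu A) = \sum_i fine (mu (A `&` C i)).
Proof.
move=> mA C0; rewrite fine_measure_partition_cover//; congr fine.
have mU := measurable_finite_cover.
rewrite -[in LHS](setIT A) -(setUv (\bigcup_i C i)) setIUr measureU0//.
- exact: measurableI.
- by apply: measurableI => //; exact: measurableC.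
- apply: (@subset_measure0 _ _ _ mu _ (~` \bigcup_i C i)) => //.
  + by apply: measurableI => //; exact: measurableC.
  + exact: measurableC.
Qed.

End Partition.

Section Box.
Context {d : nat}.

(** Indexes the cubes whose coordinates lie in [-N, N]; a finite type, so that the power sum lemmas
    apply. [box_vec] undoes the shift by [N]. *)
Definition box (N : nat) : finType := {ffun 'I_d -> 'I_(N.*2.+1)}.

Definition box_vec N (b : box N) : 'rV[int]_d :=
  \row_i ((b i : nat)%:Z - N%:Z).

Lemma box_vec_inj N : injective (@box_vec N).
Proof.
move=> b c /rowP bc; apply/ffunP => i; apply: val_inj => /=.
by have := bc i; rewrite !mxE => /addIr[].
Qed.

Lemma box_vec_surj N (k : 'rV[int]_d) : (forall i, `|k ord0 i| <= N%:Z) ->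
  exists b : box N, box_vec b = k.
Proof.
move=> kN; exists [ffun i => inord (absz (k ord0 i + N%:Z))].
apply/rowP => i; rewrite !mxE ffunE inordK; last first.
  by move: (kN i); move: (k ord0 i) => z; lia.
by move: (kN i); move: (k ord0 i) => z; lia.
Qed.

Definition box_near (M N : nat) : rel (box N) :=
  fun b c => [forall i, ((b i <= c i + M) && (c i <= b i + M))%N].

Lemma box_near_card M N (b : box N) :
  (#|[pred c | box_near M b c]| <= M.*2.+1 ^ d)%N.
Proof.
rewrite -[X in (_ <= _ ^ X)%N](card_ord d) -[X in (_ <= X ^ _)%N](card_ord M.*2.+1).
rewrite -card_ffun.
(* The offset from [b], shifted by [M] into 0..2M. The truncated subtraction is exact because
   [box_near] gives b i <= c i + M. *)
pose f (c : box N) : {ffun 'I_d -> 'I_(M.*2.+1)} :=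
  [ffun i => inord (c i + M - b i)].
rewrite -(@card_in_imset _ _ f); first exact: max_card.
move=> c c'; rewrite !inE => /forallP bc /forallP bc' /ffunP e.
apply/ffunP => i; apply: val_inj => /=.
have /andP[h1 h2] := bc i; have /andP[h3 h4] := bc' i.
have := congr1 val (e i); rewrite !ffunE /= !inordK; move: h1 h2 h3 h4;
  by move: (nat_of_ord (b i)) (nat_of_ord (c i)) (nat_of_ord (c' i)) => x y z; lia.
Qed.

Lemma box_nearC M N (b c : box N) : box_near M b c = box_near M c b.
Proof. by apply: eq_forallb => i; rewrite andbC. Qed.

End Box.
Arguments box d N : clear implicits.

Section Geometry.
Context {R : realType} {d : nat}.
Implicit Types (x y : 'rV[R]_d).

Lemma rv_norm_le x (c : R) : 0 <= c -> (forall i, `|x ord0 i| <= c) -> `|x| <= c.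
Proof.
move=> c0 xc; rewrite [leLHS]/Num.norm/= mx_normrE; apply: bigmax_le => // -[i j] _.
by rewrite (ord1 i).
Qed.

Lemma rv_coord_le_norm x i : `|x ord0 i| <= `|x|.
Proof.
rewrite [leRHS]/Num.norm/= mx_normrE.
by apply: (@le_bigmax _ _ _ _ (fun ij : 'I_1 * 'I_d => `|x ij.1 ij.2|) (ord0, i)).
Qed.

Lemma norm_le_enorm x : `|x| <= enorm x.
Proof.
apply: rv_norm_le => [|i]; first exact: sqrtr_ge0.
rewrite -sqrtr_sqr ler_wsqrtr// (bigD1 i)//= lerDl.
by apply: sumr_ge0 => j _; exact: sqr_ge0.
Qed.

Lemma enorm_le_norm x : (0 < d)%N -> enorm x <= d%:R * `|x|.
Proof.
move=> d0; rewrite /enorm.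
have h : 0 <= d%:R * `|x| by rewrite mulr_ge0.
rewrite -[leRHS]ger0_norm// -sqrtr_sqr ler_wsqrtr// exprMn.
apply: (@le_trans _ _ (\sum_(i < d) `|x| ^+ 2)).
  apply: ler_sum => i _; rewrite -[leLHS]real_normK ?num_real//.
  by rewrite lerXn2r ?nnegrE// rv_coord_le_norm.
rewrite sumr_const card_ord -[leLHS]mulr_natl ler_wpM2r ?sqr_ge0//.
by rewrite -natrX ler_nat; rewrite expnS expn1 leq_pmulr.
Qed.

Definition cell (n N : nat) (b : box d N) : set (borelRd R d) :=
  dyadic_cube n (box_vec b).

Lemma dyadic_cube_inj n : injective (@dyadic_cube R d n).
Proof.
move=> k l kl; pose x : 'rV[R]_d := \row_i ((k ord0 i)%:~R / 2 ^+ n).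
have p2 : 0 < (2 : R) ^+ n by rewrite exprn_gt0.
have : dyadic_cube n k x.
  by move=> i; rewrite mxE lexx/= ltr_pM2r ?invr_gt0// ltr_int ltrDl.
rewrite kl => xl; apply/rowP => i.
have := xl i; rewrite mxE ler_pM2r ?invr_gt0// ltr_pM2r ?invr_gt0//.
by rewrite ler_int ltr_int; move: (k ord0 i) (l ord0 i) => u v; lia.
Qed.

Lemma dyadic_cube_floor n x :
  dyadic_cube n (\row_i Num.floor (2 ^+ n * x ord0 i)) x.
Proof.
move=> i; have p2 : 0 < (2 : R) ^+ n by rewrite exprn_gt0.
by rewrite mxE ler_pdivrMr// ltr_pdivlMr// mulrC floor_itv.
Qed.

Lemma dyadic_cube_coord n k x i : dyadic_cube n k x ->
  (k ord0 i)%:~R <= 2 ^+ n * x ord0 i < (k ord0 i)%:~R + 1.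
Proof.
move=> /(_ i); have p2 : 0 < (2 : R) ^+ n by rewrite exprn_gt0.
by rewrite ler_pdivrMr// ltr_pdivlMr// mulrC intrD.
Qed.

Lemma dyadic_cube_disjoint n k l x : dyadic_cube n k x -> dyadic_cube n l x ->
  k = l.
Proof.
move=> kx lx; apply/rowP => i.
have /andP[k1 k2] := dyadic_cube_coord i kx.
have /andP[l1 l2] := dyadic_cube_coord i lx.
have := le_lt_trans k1 l2; have := le_lt_trans l1 k2.
by rewrite -!(intrD _ _ 1) !ltr_int; move: (k ord0 i) (l ord0 i) => u v; lia.
Qed.

Lemma trivIset_cell n N : trivIset setT (@cell n N).
Proof.
by move=> b c _ _ [x [bx cx]]; apply: box_vec_inj; exact: dyadic_cube_disjoint bx cx.
Qed.

Lemma dyadic_cube_diam n k x y : dyadic_cube n k x -> dyadic_cube n k y ->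
  `|x - y| <= (2 ^+ n)^-1.
Proof.
move=> kx ky; have p2 : 0 < (2 : R) ^+ n by rewrite exprn_gt0.
apply: rv_norm_le => [|i]; first by rewrite invr_ge0 ltW.
have /andP[k1 k2] := dyadic_cube_coord i kx.
have /andP[l1 l2] := dyadic_cube_coord i ky.
rewrite !mxE -(ler_pM2l p2) divff ?gt_eqF//.
rewrite -[X in X * _](gtr0_norm p2) -normrM mulrBr ler_norml.
by apply/andP; split; lra.
Qed.

(** At scale 2^-n the coordinates differ by at most [s]; the extra 1 pays for rounding a point down
    to the corner of its cube. *)
Lemma cell_near n N M (b c : box d N) (x y : 'rV[R]_d) (s : R) :
  cell n b x -> cell n c y -> `|x - y| <= s / 2 ^+ n -> s + 1 <= M%:R ->
  box_near M b c.
Proof.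
move=> bx cy xy sM; have p2 : 0 < (2 : R) ^+ n by rewrite exprn_gt0.
apply/forallP => i.
have /andP[k1 k2] := dyadic_cube_coord i bx.
have /andP[l1 l2] := dyadic_cube_coord i cy.
have h : `|2 ^+ n * x ord0 i - 2 ^+ n * y ord0 i| <= s.
  rewrite -mulrBr normrM (gtr0_norm p2) mulrC -ler_pdivlMr//.
  by apply: le_trans xy; have := rv_coord_le_norm (x - y) i; rewrite !mxE.
move: h; rewrite ler_norml => /andP[h1 h2].
have e1 : ((box_vec b ord0 i)%:~R : R) < (box_vec c ord0 i + 1 + M%:Z)%:~R.
  by rewrite !intrD -[M%:Z%:~R]/(M%:R : R); lra.
have e2 : ((box_vec c ord0 i)%:~R : R) < (box_vec b ord0 i + 1 + M%:Z)%:~R.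
  by rewrite !intrD -[M%:Z%:~R]/(M%:R : R); lra.
by move: e1 e2; rewrite !ltr_int !mxE; lia.
Qed.

Lemma cell_cover n N (L : R) (x : 'rV[R]_d) : 2 ^+ n * L + 1 <= N%:R ->
  `|x| <= L -> exists b : box d N, cell n b x.
Proof.
move=> LN xL; have p2 : 0 < (2 : R) ^+ n by rewrite exprn_gt0.
have [|b bE] := @box_vec_surj d N (\row_i Num.floor (2 ^+ n * x ord0 i)).
  move=> i; rewrite mxE; set t := 2 ^+ n * _.
  have : `|t| <= 2 ^+ n * L.
    rewrite /t normrM (gtr0_norm p2) ler_wpM2l ?(ltW p2)//.
    exact: le_trans (rv_coord_le_norm _ _) xL.
  rewrite ler_norml => /andP[t1 t2].
  have /andP[f1 f2] := floor_itv t.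
  rewrite -(ler_int R) -[N%:Z%:~R]/(N%:R : R) intr_norm ler_norml.
  by move: f2; rewrite intrD => f2; apply/andP; split; lra.
by exists b; rewrite /cell bE; exact: dyadic_cube_floor.
Qed.

End Geometry.

(** * Similarities and self-similar measures *)

Section BorelSets.
Context {R : realType} {d : nat}.

Lemma measurable_open (U : set 'rV[R]_d) :
  open U -> measurable (U : set (borelRd R d)).
Proof. exact: sub_sigma_algebra. Qed.

Lemma measurable_dyadic_cube n k :
  measurable (@dyadic_cube R d n k : set (borelRd R d)).
Proof.
have mlt i (c : R) : measurable ([set x : 'rV[R]_d | x ord0 i < c] : set (borelRd R d)).
  apply: measurable_open.
  rewrite (_ : [set x | _] = (fun x : 'rV[R]_d => x ord0 i) @^-1` [set y | y < c])//.
  by apply: open_comp; [move=> x _; exact: coord_continuous|exact: open_lt].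
rewrite (_ : dyadic_cube n k = \bigcap_(i in [set: 'I_d])
   ([set x : borelRd R d | (x : 'rV[R]_d) ord0 i < (k ord0 i + 1)%:~R / 2 ^+ n] `\`
    [set x : borelRd R d | (x : 'rV[R]_d) ord0 i < (k ord0 i)%:~R / 2 ^+ n])).
  apply: fin_bigcap_measurable => // i _; exact: measurableD.
apply/seteqP; split => [x kx i _ | x kx i].
  have /andP[k1 k2] := kx i; split => //=; apply/negP; rewrite -leNgt//.
by have [/= -> /negP] := kx i Logic.I; rewrite -leNgt => ->.
Qed.

Lemma measurable_norm_gt (c : R) :
  measurable ([set x : 'rV[R]_d | c < `|x|] : set (borelRd R d)).
Proof.
apply: measurable_open.
rewrite (_ : [set x | _] = (fun x : 'rV[R]_d => `|x|) @^-1` [set y | c < y])//.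
by apply: open_comp; [move=> x _; exact: norm_continuous|exact: open_gt].
Qed.

Lemma continuous_preimage_measurable (f : 'rV[R]_d -> 'rV[R]_d)
    (B : set (borelRd R d)) : continuous f -> measurable B ->
  measurable (f @^-1` B : set (borelRd R d)).
Proof.
move=> cf; move: B.
rewrite -/(_ `<=` [set B | measurable (f @^-1` B : set (borelRd R d))]).
apply: smallest_sub.
  split => [|A mA|A mA] /=.
  - by rewrite preimage_set0; exact: measurable0.
  - by rewrite setTD preimage_setC; exact: measurableC.
  - by rewrite preimage_bigcup; exact: bigcupT_measurable.
move=> U oU; apply: measurable_open.
by apply: open_comp => // x _; exact: cf.
Qed.

End BorelSets.

Section Similarity.
Context {R : realType} {d : nat} (d0 : (0 < d)%N).
Variables (T : {linear 'rV[R]_d -> 'rV[R]_d}) (r : R).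
Hypotheses (r01 : 0 < r < 1) (Tr : forall x, enorm (T x) = r * enorm x).

Let r0 : 0 < r. Proof. by case/andP: r01. Qed.

Lemma iter_linearB j x y : iter j T (x - y) = iter j T x - iter j T y.
Proof. by elim: j => //= j ->; rewrite linearB. Qed.

Lemma enorm_iter j x : enorm (iter j T x) = r ^+ j * enorm x.
Proof. by elim: j => [|j ih] /=; rewrite ?mul1r// Tr ih mulrA exprS. Qed.

(** Passing to the Euclidean norm once for the whole iterate costs a single factor d; estimating [T]
    step by step in the sup norm would cost d^j. *)
Lemma norm_iter_le j x : `|iter j T x| <= d%:R * r ^+ j * `|x|.
Proof.
rewrite (le_trans (norm_le_enorm _))// enorm_iter -mulrA mulrCA.
by rewrite ler_wpM2l ?exprn_ge0 ?enorm_le_norm// ltW.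
Qed.

Lemma norm_le_iter j x : r ^+ j * `|x| <= d%:R * `|iter j T x|.
Proof.
apply: le_trans (enorm_le_norm _ d0); rewrite enorm_iter.
by rewrite ler_wpM2l ?exprn_ge0 ?norm_le_enorm// ltW.
Qed.

Lemma similarity_continuous : continuous T.
Proof.
apply: bounded_linear_continuous; apply/linear_boundedP; exists (d%:R * r).
split; first by rewrite num_real.
move=> s ds x; rewrite (le_trans (norm_iter_le 1 x))// expr1.
by rewrite ler_wpM2r// ltW.
Qed.

Lemma iter_continuous j (b : 'rV[R]_d) : continuous (fun x => iter j T x + b).
Proof.
have cT : continuous (iter j T).
  elim: j => [|j ih] y; first exact: cvg_id.
  by apply: (@continuous_comp _ _ _ (iter j T) T);
    [exact: ih|exact: similarity_continuous].
move=> x; suff : {for x, continuous (iter j T + (cst b : 'rV[R]_d -> 'rV[R]_d))} by [].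
by apply: continuousD; [exact: cT|exact: cst_continuous].
Qed.

(** The least j with r^j <= 2^-k: by minimality the ratio overshoots by at most one factor [r]. *)
Lemma scale_exists k : exists j, r * (2 ^+ k)^-1 <= r ^+ j <= (2 ^+ k)^-1.
Proof.
have p2 : 0 < (2 : R) ^+ k by rewrite exprn_gt0.
have [_ r1] := andP r01.
have ex : exists j, r ^+ j <= (2 ^+ k)^-1.
  have : (fun j => r ^+ j) @ \oo --> (0 : R).
    by apply: cvg_expr; rewrite ger0_norm ?ltW.
  have e0 : 0 < ((2 : R) ^+ k)^-1 by rewrite invr_gt0.
  move=> /cvgr0Pnorm_le /(_ _ e0)[N _ /(_ N (leqnn _))] /=.
  by rewrite ger0_norm ?exprn_ge0 ?(ltW r0)// => h; exists N.
case: (ex_minnP ex) => -[|j] hj jmin; [exists 0%N|exists j.+1]; rewrite hj andbT.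
  rewrite expr0 mulr_ile1 ?invr_ge0 ?(ltW r0) ?(ltW r1) ?(ltW p2)//.
  by rewrite invf_le1// exprn_ege1// ler1n.
rewrite exprS ler_pM2l// leNgt; apply/negP => /ltW /jmin.
by rewrite ltnn.
Qed.

Context {m : nat}.
Variables (a : 'I_m -> 'rV[R]_d) (p : 'I_m -> R).
Variable mu : probability (borelRd R d) R.
Hypotheses (hp : @prob_vectors R m p) (hmu : is_self_similar_measure T a p mu).

(** A word is recorded only by its length and translation part, since the linear part is T^j for all
    words of length j. The mu-mass of this preimage is the mass of [B] in the copy of mu belonging
    to the word. *)
Definition word_image j (b : 'rV[R]_d) (B : set (borelRd R d)) :
  set (borelRd R d) := (fun x : 'rV[R]_d => iter j T x + b) @^-1` B.

Lemma measurable_word_image j b B : measurable B -> measurable (word_image j b B).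
Proof.
by move=> mB; apply: continuous_preimage_measurable => //; exact: iter_continuous.
Qed.

(** This is the convolution of the overview: the masses [P w] at the points [b w] form the discrete
    factor. *)
Lemma self_similar_words j : exists (W : finType) (P : W -> R)
    (b : W -> 'rV[R]_d), [/\ forall w, 0 < P w, \sum_w P w = 1 &
  forall B, measurable B ->
    fine (mu B) = \sum_w P w * fine (mu (word_image j (b w) B))].
Proof.
have [p0 p1] := hp.
elim: j => [|j [W [P [b [P0 P1 PB]]]]].
  exists unit, (fun=> 1), (fun=> 0); split => //.
    by rewrite big_const card_unit /= addr0.
  move=> B mB; rewrite big_const card_unit/= addr0 mul1r; congr (fine (mu _)).
  by apply/seteqP; split => x /=; rewrite /word_image/= addr0.
(* The new letter acts last: T (T^j x + b) + a_i = T^(j+1) x + (T b + a_i). *)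
exists ('I_m * W)%type, (fun w => p w.1 * P w.2),
  (fun w => T (b w.2) + a w.1); split.
- by move=> w; rewrite mulr_gt0.
- rewrite -(pair_big xpredT xpredT (fun i w => p i * P w))/=.
  by under eq_bigr do rewrite -mulr_sumr P1 mulr1.
move=> B mB.
rewrite -(pair_big xpredT xpredT (fun i w => p i * P w *
  fine (mu (word_image j.+1 (T (b w) + a i) B))))/=.
have mf i : measurable (affine_map T (a i) @^-1` B).
  by have := @measurable_word_image 1 (a i) B mB.
rewrite (hmu mB) -sum_fine//; last first.
  by move=> i _; rewrite fin_numM// fin_num_measure.
apply: eq_bigr => i _; rewrite fineM ?fin_num_measure// PB// mulr_sumr.
apply: eq_bigr => w _; rewrite mulrA; congr (_ * fine (mu _)).
by apply/seteqP; split => x; rewrite /word_image/affine_map/= linearD addrA.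
Qed.

(** Take j such that T^j at least halves norms, and let c bound the translations of the words of
    length j. Self-similarity bounds the mass beyond radius t by the mass beyond 2 (t - c). Past the
    fixed point 2c these radii run off to infinity, where the tails vanish. *)
Lemma self_similar_bounded_support :
  exists2 L : R, 0 < L & mu [set x : 'rV[R]_d | L < `|x|] = 0%E.
Proof.
have [j jr] : exists j, d%:R * r ^+ j <= 2^-1.
  have [k dk] : exists k, d%:R * (2 ^+ k)^-1 <= (2^-1 : R).
    exists d.+1; rewrite exprS invfM mulrCA ler_piMr ?invr_ge0//.
    rewrite ler_pdivrMr ?exprn_gt0// mul1r -natrX ler_nat ltnW// ltn_expl//.
  have [j /andP[_ h]] := scale_exists k; exists j.
  by apply: le_trans dk; rewrite ler_wpM2l.
have [W [P [b [P0 P1 PB]]]] := self_similar_words j.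
pose c : R := \sum_w `|b w|.
have c0 : 0 <= c by apply: sumr_ge0.
have bc w : `|b w| <= c by rewrite /c (bigD1 w)//= lerDl sumr_ge0.
pose g (t : R) := fine (mu [set x : 'rV[R]_d | t < `|x|]).
have expand t w (x : 'rV[R]_d) :
    t < `|iter j T x + b w| -> 2 * (t - c) < `|x|.
  move=> /lt_le_trans /(_ (ler_normD _ _)).
  have h2 : `|iter j T x| <= 2^-1 * `|x|.
    by apply: le_trans (norm_iter_le _ _) _; rewrite ler_wpM2r.
  by have := bc w; lra.
have step t : g t <= g (2 * (t - c)).
  rewrite /g PB; last exact: measurable_norm_gt.
  rewrite -[leRHS]mul1r -[X in _ <= X * _]P1 mulr_suml; apply: ler_sum => w _.
  rewrite ler_wpM2l ?(ltW (P0 w))//; apply: fine_measure_le.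
  - by apply: measurable_word_image; exact: measurable_norm_gt.
  - exact: measurable_norm_gt.
  by move=> x; exact: expand.
(* The radii 2c + 2^l are the orbit of 2c + 1 under t -> 2 (t - c). *)
pose F (l : nat) : set (borelRd R d) :=
  [set x : 'rV[R]_d | 2 * c + 2 ^+ l < `|x|].
have mF l : measurable (F l) by exact: measurable_norm_gt.
have stepF l : fine (mu (F 0%N)) <= fine (mu (F l)).
  elim: l => // l ih; apply: le_trans ih _.
  have -> : fine (mu (F l.+1)) = g (2 * (2 * c + 2 ^+ l - c)).
    rewrite (_ : 2 * (2 * c + 2 ^+ l - c) = 2 * c + 2 ^+ l.+1)//.
    by rewrite exprS; ring.
  exact: step.
have capF : \bigcap_l F l = set0.
  apply/seteqP; split => // x xF.
  have := xF (Num.bound `|x|) Logic.I; rewrite /F/= ltNge => /negP; apply.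
  have : `|x| < 2 ^+ Num.bound `|x|.
    apply: lt_trans (archi_boundP _) _ => //.
    by rewrite -natrX ltr_nat ltn_expl.
  by move=> /ltW/le_trans; apply; rewrite lerDr mulr_ge0.
exists (2 * c + 1); first lra.
have cvF : mu \o F @ \oo --> mu (\bigcap_l F l).
  apply: nonincreasing_cvg_mu => //.
  - by rewrite ltey_eq fin_num_measure.
  - by rewrite capF.
  - move=> k l kl; apply/subsetPset => x; rewrite /F/=; apply: le_lt_trans.
    by rewrite lerD2l ler_weXn2l ?ler1n.
move: cvF; rewrite capF measure0 => cvF.
have -> : [set x : 'rV[R]_d | 2 * c + 1 < `|x|] = F 0%N by rewrite /F expr0.
apply/eqP; rewrite eq_le measure_ge0 andbT.
rewrite -(cvg_lim _ cvF)//; apply: lime_ge; first by apply/cvg_ex; exists 0%E.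
apply: nearW => l /=.
by rewrite -(@fineK _ (mu (F 0%N))) ?fin_num_measure// -(@fineK _ (mu (F l)))
  ?fin_num_measure// lee_fin.
Qed.

End Similarity.

(** * Submultiplicativity of the moment sums *)

Section CellMasses.
Context {R : realType} {d : nat}.
Variables (mu : probability (borelRd R d) R) (L : R).
Hypotheses (L0 : 0 < L) (muL : mu [set x : 'rV[R]_d | L < `|x|] = 0%E).

Definition box_radius n : nat := Num.bound (2 ^+ n * L + 1).

Definition cell_mass n (b : box d (box_radius n)) : R := fine (mu (cell n b)).

Definition cell_power_sum q n : R := \sum_b cell_mass (n := n) b `^ q.

Lemma measurable_cell n N (b : box d N) : measurable (cell n b : set (borelRd R d)).
Proof. exact: measurable_dyadic_cube. Qed.

Lemma cell_mass_ge0 n b : 0 <= cell_mass (n := n) b.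
Proof. exact: fine_measure_ge0. Qed.

Lemma cell_cover_box n (x : 'rV[R]_d) : `|x| <= L ->
  exists b : box d (box_radius n), cell n b x.
Proof.
apply: cell_cover; apply: ltW; apply: archi_boundP.
by rewrite addr_ge0 ?mulr_ge0 ?exprn_ge0 ?(ltW L0).
Qed.

(** Turns masses into geometry: nonzero masses yield points of bounded norm whose distances can be
    estimated. *)
Lemma positive_mass_point (A : set (borelRd R d)) : measurable A ->
  fine (mu A) != 0 -> exists2 x : 'rV[R]_d, A x & `|x| <= L.
Proof.
move=> mA; apply: contraNP => nA; apply/eqP.
apply: (fine_measure_null mA (measurable_norm_gt L) muL) => x Ax /=.
by rewrite ltNge; apply/negP => xL; apply: nA; exists x.
Qed.

(** The map [f] is the identity when mu itself is cut into cells, and a word map when a copy of mu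
    is. *)
Lemma cells_cover_null n (f : 'rV[R]_d -> 'rV[R]_d) : continuous f ->
  mu (f @^-1` [set x : 'rV[R]_d | L < `|x|]) = 0%E ->
  mu (~` \bigcup_(b : box d (box_radius n)) (f @^-1` cell n b)) = 0%E.
Proof.
move=> cf f0; apply: (@subset_measure0 _ _ _ mu _
    (f @^-1` [set x : 'rV[R]_d | L < `|x|])) => //.
- apply: measurableC; apply: measurable_finite_cover => b.
  exact: continuous_preimage_measurable cf (measurable_cell n b).
- exact: continuous_preimage_measurable cf (measurable_norm_gt L).
- move=> x xn /=; rewrite ltNge; apply/negP => fxL; apply: xn.
  by have [b bx] := cell_cover_box n fxL; exists b.
Qed.

Lemma trivIset_preimage_cell n N (f : 'rV[R]_d -> 'rV[R]_d) :
  trivIset setT (fun b : box d N => f @^-1` cell n b : set (borelRd R d)).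
Proof.
by move=> b c _ _ [x [/= bx cx]]; apply: (trivIset_cell (n := n)) => //; exists (f x).
Qed.

Lemma cell_partition n (A : set (borelRd R d)) : measurable A ->
  fine (mu A) = \sum_(b : box d (box_radius n)) fine (mu (A `&` cell n b)).
Proof.
move=> mA; apply: fine_measure_partition => //.
- by move=> b; exact: measurable_cell.
- exact: trivIset_cell.
- by apply: (@cells_cover_null n id) => // x; exact: cvg_id.
Qed.

Lemma cell_mass_sum1 n : \sum_b cell_mass (n := n) b = 1.
Proof.
have := cell_partition n (@measurableT _ (borelRd R d)).
rewrite probability_setT /= => ->; apply: eq_bigr => b _.
by rewrite setTI.
Qed.

Lemma cell_mass_le1 n b : cell_mass (n := n) b <= 1.
Proof.
rewrite -(cell_mass_sum1 n) (bigD1 b)//= lerDl sumr_ge0// => c _.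
exact: cell_mass_ge0.
Qed.

End CellMasses.

Section Submultiplicativity.
Context {R : realType} {d m : nat} (d0 : (0 < d)%N).
Variables (T : {linear 'rV[R]_d -> 'rV[R]_d}) (r : R).
Hypotheses (r01 : 0 < r < 1) (Tr : forall x, enorm (T x) = r * enorm x).
Variables (a : 'I_m -> 'rV[R]_d) (p : 'I_m -> R).
Variable mu : probability (borelRd R d) R.
Hypotheses (hp : @prob_vectors R m p) (hmu : is_self_similar_measure T a p mu).
Variable L : R.
Hypotheses (L0 : 0 < L) (muL : mu [set x : 'rV[R]_d | L < `|x|] = 0%E).

(* The factor tends to [1] as [q -> 1], so it survives the division of
   logarithms by [q - 1]. *)
Lemma cell_power_sum_submul : exists2 C : R, 0 <= C &
  forall q n k, 1 < q <= 2 ->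
    cell_power_sum mu L q (n + k) <= expR ((q - 1) * C) *
      (cell_power_sum mu L q n * cell_power_sum mu L q k).
Proof.
have [r0 r1] := andP r01.
set D : R := d%:R.
have D0 : 0 < D by rewrite ltr0n.
have Dr0 : 0 < D / r by rewrite divr_gt0.
have DL0 : 0 < D * L by rewrite mulr_gt0.
(* One [M] serves both uses of [cell_near], with s = 4 D L + 1 and with s = D / r. *)
pose M := Num.bound (4 * (D * L) + 2 + (D / r + 1)).
have hM : 4 * (D * L) + 2 + (D / r + 1) <= M%:R.
  by apply: ltW; apply: archi_boundP; lra.
pose A := (M.*2.+1 ^ d)%N.
have A0 : 0 < (A%:R : R) by rewrite ltr0n expn_gt0.
have A1 : 1 <= (A%:R : R) by rewrite ler1n expn_gt0.
(* The term ln A comes from A^(q - 1) in [power_sum_partition], the term A^2 from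
   [power_sum_near]. *)
exists (ln A%:R + A%:R ^+ 2); first by rewrite addr_ge0 ?ln_ge0 ?sqr_ge0.
move=> q n k /andP[q1 q2].
have [j /andP[rhol rhou]] := scale_exists r01 k.
have [W [P [b [P0 P1 PB]]]] := self_similar_words d0 r01 Tr hp hmu j.
have rho0 : 0 < r ^+ j by rewrite exprn_gt0.
have pk : 0 < (2 : R) ^+ k by rewrite exprn_gt0.
have pn : 0 < (2 : R) ^+ n by rewrite exprn_gt0.
pose f w (x : 'rV[R]_d) := iter j T x + b w.
have cf w : continuous (f w) by exact: (iter_continuous d0 r01 Tr).
have fB w x y : f w x - f w y = iter j T (x - y).
  by rewrite iter_linearB /f opprD addrACA subrr addr0.
pose fpre w := word_image T j (b w).
have mpre w (B : set (borelRd R d)) : measurable B -> measurable (fpre w B).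
  by move=> mB; exact: (continuous_preimage_measurable (cf w) mB).
have mc i N (c : box d N) : measurable (cell i c : set (borelRd R d)).
  exact: measurable_cell.
(* mu is a combination of the copies with positive weights, so each copy is null wherever mu is. *)
have fnull w : mu (fpre w [set x : 'rV[R]_d | L < `|x|]) = 0%E.
  have mg := measurable_norm_gt (d := d) L.
  have := PB _ mg; rewrite muL /= => /esym/eqP.
  rewrite psumr_eq0; last first.
    by move=> v _; rewrite mulr_ge0 ?fine_measure_ge0 ?(ltW (P0 v)).
  move=> /allP /(_ w (mem_index_enum _)) /=; rewrite mulf_eq0 gt_eqF//=.
  by rewrite fine_eq0 ?fin_num_measure//; [move/eqP|exact: mpre].
pose alpha w (i : box d (box_radius L (n + k))) := fine (mu (fpre w (cell (n + k) i))).
pose beta w (i : box d (box_radius L k)) := fine (mu (fpre w (cell k i))).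
(* The preimage of a cube of level n + k has diameter at most D 2^-(n+k) / r^j <= (D / r) 2^-n,
   hence meets boundedly many cubes of level n. *)
have halpha w : \sum_i alpha w i `^ q <=
    A%:R `^ (q - 1) * cell_power_sum mu L q n.
  pose g (i : box d (box_radius L (n + k))) (c : box d (box_radius L n)) :=
    fine (mu (fpre w (cell (n + k) i) `&` cell n c)).
  have -> : \sum_i alpha w i `^ q =
      \sum_i (\sum_c g i c) `^ q.
    apply: eq_bigr => i _; congr (_ `^ _); apply: (cell_partition L0 muL).
    exact: mpre.
  apply: le_trans (@power_sum_partition _ _ _ g A q q1 _ _) _.
  - by move=> i c; exact: fine_measure_ge0.
  - move=> i; have [[c0 gc0]|ngc] := pselect (exists c, g i c != 0); last first.
      rewrite eq_card0// => c; apply/negbTE/negP; rewrite inE => gc.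
      by apply: ngc; exists c.
    apply: leq_trans (box_near_card M c0); apply: subset_leq_card.
    apply/fintype.subsetP => c; rewrite !inE => gc.
    have [x [xi xc0] _] := positive_mass_point muL
      (measurableI _ _ (mpre w _ (mc _ _ i)) (mc _ _ c0)) gc0.
    have [y [yi yc] _] := positive_mass_point muL
      (measurableI _ _ (mpre w _ (mc _ _ i)) (mc _ _ c)) gc.
    apply: (cell_near (s := D / r) xc0 yc); last lra.
    have h := dyadic_cube_diam xi yi; rewrite fB in h.
    rewrite -(ler_pM2l rho0); apply: le_trans (norm_le_iter d0 r01 Tr j _) _.
    apply: (@le_trans _ _ (D * (2 ^+ (n + k))^-1)); first by rewrite ler_pM2l.
    rewrite -(ler_pM2r pn) mulrA divfK ?gt_eqF// exprD invfM.
    rewrite mulrA mulrAC divfK ?gt_eqF//.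
    have -> : D / 2 ^+ k = r * (2 ^+ k)^-1 * (D / r).
      by field; rewrite !gt_eqF.
    by rewrite ler_pM2r.
  - rewrite ler_wpM2l ?powR_ge0//; apply: ler_sum => c _.
    apply: ge0_ler_powR; rewrite ?nnegrE ?fine_measure_ge0//; first lra.
      by apply: sumr_ge0 => i _; exact: fine_measure_ge0.
    under eq_bigr do rewrite /g setIC.
    apply: fine_measure_partition_le => //.
    + by move=> i; apply: mpre.
    + exact: trivIset_preimage_cell.
have hbeta w : P w != 0 -> \sum_i beta w i = 1.
  move=> _; rewrite -[RHS]/(fine 1%E) -(probability_setT mu).
  rewrite (@fine_measure_partition _ _ _ mu _
    (fun c : box d (box_radius L k) => fpre w (cell k c)))//.
  - by apply: eq_bigr => c _; rewrite setTI.
  - by move=> c; exact: mpre.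
  - exact: trivIset_preimage_cell.
  - exact: (cells_cover_null L0 _ (cf w) (fnull w)).
(* Each word map sends the ball of radius [L] to a set of diameter at most 2 D L 2^-k, and the cube
   [i] has side at most 2^-k. Going through the two points in [i] gives 4 D L + 1. *)
have hnear i w w' c c' : alpha w i != 0 -> alpha w' i != 0 ->
    beta w c != 0 -> beta w' c' != 0 -> box_near M c c'.
  move=> awi aw'i bwc bw'c'.
  have [x xi xL] := positive_mass_point muL (mpre w _ (mc _ _ i)) awi.
  have [x' xi' xL'] := positive_mass_point muL (mpre w' _ (mc _ _ i)) aw'i.
  have [y yc yL] := positive_mass_point muL (mpre w _ (mc _ _ c)) bwc.
  have [y' yc' yL'] := positive_mass_point muL (mpre w' _ (mc _ _ c')) bw'c'.
  apply: (cell_near (s := 4 * (D * L) + 1) yc yc'); last lra.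
  have cl v (u u' : 'rV[R]_d) : `|u| <= L -> `|u'| <= L ->
      `|f v u - f v u'| <= 2 * (D * L) / 2 ^+ k.
    move=> uL u'L; rewrite fB; apply: le_trans (norm_iter_le d0 r01 Tr j _) _.
    have h : `|u - u'| <= 2 * L.
      by apply: le_trans (ler_normB _ _) _; rewrite mulr2n mulrDl mul1r lerD.
    have -> : 2 * (D * L) / 2 ^+ k = D * (2 ^+ k)^-1 * (2 * L) by ring.
    by apply: ler_pM => //; rewrite ?mulr_ge0 ?(ltW rho0) ?(ltW D0)// ler_pM2l.
  have h1 := cl w y x yL xL; have h2 := cl w' x' y' xL' yL'.
  have h3 : `|f w x - f w' x'| <= 1 / 2 ^+ k.
    apply: le_trans (dyadic_cube_diam xi xi') _.
    by rewrite div1r lef_pV2 ?posrE ?exprn_gt0// ler_weXn2l ?ler1n// leq_addl.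
  have -> : f w y - f w' y' =
      (f w y - f w x) + (f w x - f w' x') + (f w' x' - f w' y').
    by rewrite !subrKA.
  apply: le_trans (ler_normD _ _) _.
  apply: le_trans (lerD (ler_normD _ _) (lexx _)) _.
  have -> : (4 * (D * L) + 1) / 2 ^+ k = 2 * (D * L) / 2 ^+ k + 1 / 2 ^+ k +
    2 * (D * L) / 2 ^+ k by field; rewrite gt_eqF.
  by rewrite !lerD.
have massE i N (c : box d N) :
    fine (mu (cell i c)) = \sum_w P w * fine (mu (fpre w (cell i c))).
  exact: PB.
rewrite {1}/cell_power_sum /cell_mass.
under eq_bigr do rewrite massE.
have := @power_sum_submul R W _ _ (@box_near d M _) P alpha beta _ q q1
  (fun w => ltW (P0 w)) P1 (fun w i => fine_measure_ge0 _ _)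
  (fun w i => fine_measure_ge0 _ _) hbeta hnear halpha.
move=> /le_trans; apply.
have -> : \sum_j0 (\sum_w P w * beta w j0) *
   (\sum_(j' | box_near M j0 j') \sum_w P w * beta w j') `^ (q - 1) =
  \sum_c cell_mass mu (L := L) (n := k) c *
   (\sum_(c' | box_near M c c') cell_mass mu (L := L) c') `^ (q - 1).
  apply: eq_bigr => c _; congr (_ * _ `^ _); first by rewrite /cell_mass massE.
  by apply: eq_bigr => c' _; rewrite /cell_mass massE.
have near := @power_sum_near R _ (@box_near d M _) (@cell_mass _ _ mu L k) A q q1 q2
  (fun c => cell_mass_ge0 _ c) (fun c => box_near_card M c).
apply: le_trans (ler_wpM2l _ (near _)) _.
- rewrite mulr_ge0 ?powR_ge0//; apply: sumr_ge0 => c _; exact: powR_ge0.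
- move=> c; rewrite (@eq_card _ _ [pred c' | box_near M c c']).
    exact: box_near_card.
  by move=> c'; rewrite !inE box_nearC.
rewrite [A%:R `^ _]/powR gt_eqF// mulrDr expRD le_eqVlt; apply/orP; left.
by apply/eqP; rewrite /cell_power_sum; ring.
Qed.

End Submultiplicativity.

(** * Comparison of dimensions *)

Section LowerLimits.
Context {R : realType}.

Lemma limn_einf_ge (u : (\bar R)^nat) (x : \bar R) N :
  (forall n, (N <= n)%N -> (x <= u n)%E) -> (x <= limn_einf u)%E.
Proof.
move=> xu; rewrite limn_einf_lim; apply: lime_ge; first exact: is_cvg_einfs.
exists N => // n /= Nn; apply: le_ereal_inf_tmp => _ [k /= nk <-].
by apply: xu; exact: leq_trans nk.
Qed.

Lemma limn_einf_le (u v : (\bar R)^nat) : (forall n, (u n <= v n)%E) ->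
  (limn_einf u <= limn_einf v)%E.
Proof.
move=> uv; rewrite !limn_einf_lim; apply: lee_lim; try exact: is_cvg_einfs.
apply: nearW => n; apply: le_ereal_inf_tmp => _ [k /= nk <-].
by apply: le_trans (uv k); apply: ereal_inf_lbound; exists k.
Qed.

(** Keeps a strict margin y - x, to be spent on the error terms in the final estimate. *)
Lemma limn_einf_gt (v : R^nat) (x : R) :
  (x%:E < limn_einf (EFin \o v))%E ->
  exists2 y, x < y & exists N, forall n, (N <= n)%N -> y <= v n.
Proof.
rewrite limn_einf_lim (cvg_lim _ (@cvg_einfs_sup _ _))// => /ereal_sup_gt.
move=> [_ [N _ <-] xN].
have h n : (N <= n)%N -> (einfs (EFin \o v) N <= (v n)%:E)%E.
  by move=> Nn; apply: ereal_inf_lbound; exists n.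
case: (einfs (EFin \o v) N) xN h => [y| |]; rewrite ?lte_fin => xN h //.
  by exists y => //; exists N => n /h; rewrite lee_fin.
by have := h N (leqnn N).
Qed.

(** Handling infinite [l] together with finite [l] avoids a separate proof that [D1 mu] is
    finite. *)
Lemma ereal_cvg_from_below {U : Type} {F : set_system U} {FF : ProperFilter F}
    (f : U -> \bar R) (l : \bar R) :
  (\forall t \near F, (f t <= l)%E) ->
  (forall x : R, (x%:E < l)%E -> \forall t \near F, (x%:E <= f t)%E) ->
  f @ F --> l.
Proof.
case: l => [l| |] fl lf.
- apply/fine_cvgP; split.
    have h := lf (l - 1) _.
    near=> t; have ft : (f t <= l%:E)%E by near: t.
    have : ((l - 1)%:E <= f t)%E by near: t; apply: h; rewrite lte_fin; lra.
    by move: ft; case: (f t).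
  apply/cvgrPdist_le => e e0.
  near=> t; have ft : (f t <= l%:E)%E by near: t.
  have : ((l - e)%:E <= f t)%E by near: t; apply: lf; rewrite lte_fin; lra.
  move: ft; rewrite /=; case: (f t) => //= y; rewrite !lee_fin => yl ly.
  by rewrite ler_norml; apply/andP; split; lra.
- by apply/cvgeyPge => A; apply: lf; rewrite ltry.
- apply: cvg_near_cst; near=> t.
  by apply/eqP; rewrite -leeNy_eq; near: t.
Unshelve. all: by end_near. Qed.

(** Fekete's argument with a fixed step: write n as a multiple of [k] plus a remainder and discard
    the nonnegative value of [g] at the remainder. *)
Lemma superadditive_growth (g : nat -> R) (k : nat) (y : R) : (0 < k)%N ->
  0 <= y -> (forall n, 0 <= g n) ->
  (forall n, g n + k%:R * y <= g (n + k)%N) ->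
  forall n, (n%:R - k%:R) * y <= g n.
Proof.
move=> k0 y0 g0 gk n.
have h a b : a%:R * (k%:R * y) <= g (b + a * k)%N.
  elim: a => [|a ih]; first by rewrite mul0r.
  rewrite mulSn addnCA addnC; apply: le_trans (gk _).
  by rewrite -natr1 mulrDl mul1r lerD.
have := h (n %/ k)%N (n %% k)%N; rewrite addnC -divn_eq; apply: le_trans.
rewrite mulrA ler_wpM2r// -natrM lerBlDr -natrD ler_nat.
by rewrite {1}(divn_eq n k) leq_add2l ltnW// ltn_pmod.
Qed.

End LowerLimits.

(** * Moments and entropy as finite sums over cells *)

Section CellSums.
Context {R : realType} {d : nat}.
Variables (mu : probability (borelRd R d) R) (L : R).
Hypotheses (L0 : 0 < L) (muL : mu [set x : 'rV[R]_d | L < `|x|] = 0%E).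

(** A cube of nonzero mass contains a point of norm at most [L], hence is a cell of the box; [Fnull]
    discards all other cubes. *)
Lemma dyadic_esum n (F : set 'rV[R]_d -> \bar R) :
  (forall I, (@dyadic_cubes R d n) I -> (0 <= F I)%E) ->
  (forall I, (@dyadic_cubes R d n) I -> mu I = 0%E -> F I = 0%E) ->
  (\esum_(I in @dyadic_cubes R d n) F I =
     \sum_(b : box d (box_radius L n)) F (cell n b))%E.
Proof.
move=> F0 Fnull; rewrite /dyadic_cubes esum_image; last first.
  by move=> k l _ _; exact: dyadic_cube_inj.
transitivity (\esum_(k in range (@box_vec d (box_radius L n))) F (dyadic_cube n k))%E.
  rewrite [RHS]esum_mkcond; apply: eq_esum => k _.
  case: ifPn => // /negP kn; apply: Fnull; first by exists k.
  have mk := @measurable_dyadic_cube R d n k.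
  apply/eqP; apply/negPn/negP => muk.
  have muk' : fine (mu (dyadic_cube n k)) != 0.
    by rewrite fine_eq0// fin_num_measure.
  have [x xk xL] := positive_mass_point muL mk muk'.
  have [b bx] := cell_cover_box L0 n xL.
  apply: kn; rewrite inE; exists b => //.
  exact: dyadic_cube_disjoint bx xk.
rewrite esum_image; last by move=> b c _ _; exact: box_vec_inj.
rewrite (esum_fset finite_finset); last by move=> b _; apply: F0; exists (box_vec b).
have -> : [set: box d (box_radius L n)] = [set` index_enum (box d (box_radius L n))].
  by apply/seteqP; split => i //= _; rewrite mem_index_enum.
by rewrite -fsbig_seq ?index_enum_uniq.
Qed.

Lemma cell_massE n (b : box d (box_radius L n)) :
  mu (cell n b) = (cell_mass mu b)%:E.
Proof. by rewrite fineK// fin_num_measure//; exact: measurable_cell. Qed.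

Lemma moment_sumE n q : 0 < q ->
  moment_sum mu n q = (cell_power_sum mu L q n)%:E.
Proof.
move=> q0; rewrite /moment_sum dyadic_esum.
- rewrite -sumEFin; apply: eq_bigr => b _.
  by rewrite cell_massE poweR_EFin.
- by move=> I _; exact: poweR_ge0.
- by move=> I _ ->; rewrite poweR0r// gt_eqF.
Qed.

Definition cell_entropy n : R := nat_entropy (@cell_mass R d mu L n).

Lemma entropyE n : entropy mu n = (cell_entropy n / ln 2)%:E.
Proof.
have h (u : R) : 0 <= u ->
    (u%:E * log2e (u%:E)^-1 = (u * - ln u / ln 2)%:E)%E.
  move=> u0; have [->|un0] := eqVneq u 0; first by rewrite mul0e !mul0r.
  have ugt0 : 0 < u by rewrite lt_neqAle eq_sym un0.
  rewrite inver (negPf un0) /log2e lne_EFin ?invr_gt0// lnV// -!EFinM.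
  by rewrite mulrA.
rewrite /entropy dyadic_esum.
- rewrite /cell_entropy /nat_entropy mulr_suml -sumEFin.
  apply: eq_bigr => b _; rewrite cell_massE h//; exact: cell_mass_ge0.
- move=> _ [k _ <-]; have mk := @measurable_dyadic_cube R d n k.
  have mu1 := probability_le1 mu mk.
  rewrite -(fineK (fin_num_measure mu _ mk)) h ?fine_ge0// lee_fin.
  rewrite mulr_ge0 ?invr_ge0 ?ln_ge0 ?ler1n// mulr_ge0 ?fine_ge0//.
  by rewrite oppr_ge0 ln_le0// -lee_fin fineK// fin_num_measure.
- by move=> I _ ->; rewrite mul0e.
Qed.

Lemma cell_power_sum_le1 q n : 1 < q -> cell_power_sum mu L q n <= 1.
Proof.
move=> q1; apply: le_trans (powR_superadditive q1 _) _.
  by move=> b; exact: cell_mass_ge0.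
by rewrite cell_mass_sum1// powR1.
Qed.

Lemma cell_power_sum_ge q n : 1 < q ->
  expR (- ((q - 1) * cell_entropy n)) <= cell_power_sum mu L q n.
Proof.
move=> q1; apply: power_sum_ge_entropy => //; first exact: cell_mass_ge0.
exact: cell_mass_sum1.
Qed.

Lemma cell_power_sum_gt0 q n : 1 < q -> 0 < cell_power_sum mu L q n.
Proof. by move=> q1; exact: lt_le_trans (expR_gt0 _) (cell_power_sum_ge n q1). Qed.

(** The R_n(q) of the overview, in natural logarithms; [Dq_renyi] restores the factor 1 / ln 2. *)
Definition renyi q n : R := - ln (cell_power_sum mu L q n) / (q - 1).

Lemma renyi_ge0 q n : 1 < q -> 0 <= renyi q n.
Proof.
move=> q1; rewrite divr_ge0 ?oppr_ge0 ?ln_le0 ?cell_power_sum_le1//; lra.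
Qed.

Lemma renyi_le_entropy q n : 1 < q -> renyi q n <= cell_entropy n.
Proof.
move=> q1; rewrite ler_pdivrMr; last lra.
rewrite lerNl mulrC -[leLHS]expRK ler_ln ?posrE ?expR_gt0//.
  exact: cell_power_sum_ge.
exact: cell_power_sum_gt0.
Qed.

(** [B] may depend on [n], because q -> 1+ is taken at a fixed scale. The passage to the logarithm
    is ln s <= s - 1. *)
Lemma renyi_ge_entropy n : exists2 B : R, 0 <= B &
  forall q, 1 < q -> cell_entropy n - (q - 1) * B <= renyi q n.
Proof.
exists (\sum_b cell_mass mu (L := L) (n := n) b *
    ln (cell_mass mu (L := L) b) ^+ 2).
  by apply: sumr_ge0 => b _; rewrite mulr_ge0 ?sqr_ge0// cell_mass_ge0.
move=> q q1; rewrite ler_pdivlMr; last lra.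
have s0 := cell_power_sum_gt0 n q1.
have := le_ln1Dx (x := cell_power_sum mu L q n - 1).
rewrite [1 + _]addrC subrK => /(_ ltac:(lra)).
have := power_sum_le_entropy (@cell_mass_ge0 _ _ mu L n)
  (cell_mass_sum1 L0 muL n) q1 (cell_mass_le1 L0 muL (n := n)).
rewrite -/(cell_power_sum mu L q n) -/(cell_entropy n).
set B := \sum_b _; set s := cell_power_sum _ _ _ _.
rewrite [_ * (q - 1)]mulrC; set z := (q - 1) * _; lra.
Qed.

Lemma Dq_renyi q : 1 < q ->
  Dq mu q = limn_einf (EFin \o (fun n => renyi q n / ln 2 / n%:R)).
Proof.
move=> q1; rewrite /Dq; congr limn_einf; apply/funext => n /=.
rewrite moment_sumE; last lra.
rewrite /log2e lne_EFin ?cell_power_sum_gt0// -!EFinM /renyi.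
rewrite invfM (_ : (1 - q)^-1 = - (q - 1)^-1); last by rewrite -invrN opprB.
by congr EFin; ring.
Qed.

Lemma D1_entropy :
  D1 mu = limn_einf (EFin \o (fun n => cell_entropy n / ln 2 / n%:R)).
Proof.
by rewrite /D1; congr limn_einf; apply/funext => n /=; rewrite entropyE -EFinM.
Qed.

Lemma Dq_le_D1 q : 1 < q -> (Dq mu q <= D1 mu)%E.
Proof.
move=> q1; rewrite Dq_renyi// D1_entropy; apply: limn_einf_le => n /=.
rewrite lee_fin !ler_wpM2r ?invr_ge0 ?ln_ge0 ?ler1n// renyi_le_entropy//.
Qed.

End CellSums.

Theorem theorem5p1 (R : realType) (d m : nat) (hd : (0 < d)%N)
    (T : {linear 'rV[R]_d -> 'rV[R]_d})
    (hT : invertible_contractive_similarity T)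
    (a : 'I_m -> 'rV[R]_d)
    (p : 'I_m -> R) (hp : @prob_vectors R m p)
    (mu : probability (borelRd R d) R)
    (hmu : is_self_similar_measure T a p mu) :
  Dq mu q @[q --> (1 : R)^'+] --> D1 mu.
Proof.
have [_ [r r01 Tr]] := hT.
have [L L0 muL] := self_similar_bounded_support hd r01 Tr hp hmu.
have [C C0 submul] := cell_power_sum_submul hd r01 Tr hp hmu L0 muL.
have ln2 : 0 < ln (2 : R) by rewrite ln_gt0// ltr1n.
have superadd q n k : 1 < q <= 2 ->
    renyi mu L q n + renyi mu L q k - C <= renyi mu L q (n + k).
  move=> /[dup] q12 /andP[q1 q2]; have q10 : 0 < q - 1 by lra.
  have sgt i := cell_power_sum_gt0 L0 muL i q1.
  rewrite /renyi ler_pdivlMr// mulrBl mulrDl !divfK ?gt_eqF//.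
  have := submul q n k q12.
  rewrite -ler_ln ?posrE ?mulr_gt0 ?expR_gt0//.
  by rewrite !lnM ?posrE ?mulr_gt0 ?expR_gt0// expRK; lra.
apply: ereal_cvg_from_below.
  near=> q; apply: (Dq_le_D1 L0 muL); near: q; exact: nbhs_right_gt.
move=> x; rewrite (D1_entropy L0 muL) => /limn_einf_gt[y xy [N hN]].
(* For x < 0 it is enough that [Dq] is nonnegative; afterwards x >= 0 makes [z] positive, so that
   [superadditive_growth] applies. *)
have [x0|x0] := ltP x 0.
  near=> q; have q1 : 1 < q by near: q; exact: nbhs_right_gt.
  rewrite (Dq_renyi L0 muL q1); apply: (@limn_einf_ge _ _ _ 0) => n _ /=.
  rewrite lee_fin; apply: le_trans (ltW x0) _.
  apply: divr_ge0; last exact: ler0n.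
  by apply: divr_ge0; [exact: renyi_ge0|exact: ltW].
(* One [delta] pays for [C], one for replacing the entropy at scale [k] by [renyi], and z - x = 2
   delta is left for large n. *)
pose delta := (y - x) / 4.
have delta0 : 0 < delta by rewrite divr_gt0 ?subr_gt0.
(* From [N] on the entropy ratio is at least y, and the fixed loss [C] is small against a large
   [k]. *)
pose k := maxn 1 (maxn N (Num.bound (C / (ln 2 * delta)))).
have k0 : (0 < k)%N by rewrite leq_max.
have kR : 0 < (k%:R : R) by rewrite ltr0n.
have kN : (N <= k)%N by rewrite !leq_max leqnn orbT.
have kC : C <= k%:R * (ln 2 * delta).
  rewrite -ler_pdivrMr; last exact: mulr_gt0.
  apply: le_trans (ltW (archi_boundP _)) _.
    by apply: divr_ge0 => //; apply: mulr_ge0; exact: ltW.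
  by rewrite ler_nat !leq_max leqnn !orbT.
have [B B0 hB] := renyi_ge_entropy L0 muL k.
have hk : k%:R * (ln 2 * y) <= cell_entropy mu L k.
  have := hN k kN; rewrite !ler_pdivlMr// => h.
  by apply: le_trans h; rewrite le_eqVlt; apply/orP; left; apply/eqP; ring.
(* Makes (q - 1) B at most k ln 2 delta for q <= 1 + e; the denominator is B + 1 because [B] may be
   0. *)
pose e := k%:R * (ln 2 * delta) / (B + 1).
have B10 : 0 < B + 1 by lra.
have e0 : 0 < e by apply: divr_gt0 => //; do 2 apply: mulr_gt0 => //.
pose z := (x + y) / 2.
have z0 : 0 < z by rewrite /z; lra.
have zx : 0 < z - x by rewrite /z; lra.
suff key q : 1 < q -> q <= 2 -> q <= 1 + e -> (x%:E <= Dq mu q)%E.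
  near=> q; apply: key; near: q.
  - exact: nbhs_right_gt.
  - by apply: nbhs_right_le; rewrite ltr1n.
  - by apply: nbhs_right_le; rewrite ltrDl.
move=> q1 q2 qe'.
have qe : (q - 1) * B <= k%:R * (ln 2 * delta).
  apply: (@le_trans _ _ (e * (B + 1))); last by rewrite divfK// gt_eqF.
  by apply: ler_pM => //; lra.
have step n : renyi mu L q n + k%:R * (ln 2 * z) <= renyi mu L q (n + k).
  apply: le_trans (superadd q n k _); last by rewrite q1 q2.
  rewrite -addrA lerD2l; apply: le_trans (lerB (hB q q1) (lexx C)).
  have : k%:R * (ln 2 * z) =
      k%:R * (ln 2 * y) - 2 * (k%:R * (ln 2 * delta)).
    by rewrite /z /delta; field.
  lra.
have lnz0 : 0 <= ln 2 * z by rewrite mulr_ge0 ?ltW.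
have growth := superadditive_growth k0 lnz0
  (fun n => renyi_ge0 L0 muL n q1) step.
rewrite (Dq_renyi L0 muL q1).
(* The growth bound has n - k in place of n; from this rank on the missing k z is at most n (z -
   x). *)
apply: (@limn_einf_ge _ _ _ (maxn 1 (Num.bound (k%:R * z / (z - x))))) => n /=.
rewrite geq_max => /andP[n0 nb].
have nR : 0 < (n%:R : R) by rewrite ltr0n.
have nb' : k%:R * z <= n%:R * (z - x).
  rewrite -ler_pdivrMr//; apply: le_trans (ltW (archi_boundP _)) _.
    by apply: divr_ge0; [apply: mulr_ge0 => //; exact: ltW|exact: ltW].
  by rewrite ler_nat.
rewrite lee_fin ler_pdivlMr// ler_pdivlMr//; apply: le_trans (growth n).
rewrite -subr_ge0.
have -> : (n%:R - k%:R) * (ln 2 * z) - x * n%:R * ln 2 =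
  ln 2 * (n%:R * (z - x) - k%:R * z) by ring.
by rewrite mulr_ge0 ?(ltW ln2)// subr_ge0.
Unshelve. all: by end_near. Qed.
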